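(* Let $K$ be a composite knot, $K = K_1 \# K_2 \# \cdots \# K_n$ with $n \ge 2$ and each $K_j$ a nontrivial prime knot. Then there exist a diagram of $K$ and a labeling of its crossings for which the trip matrix $T_K$ is block diagonal with diagonal blocks $T_1, \dots, T_n$, where for each $j$ the block $T_j$ is a trip matrix of (a labeled diagram of) the component $K_j$.
   Context: Trip matrix. Let $D$ be a diagram of a knot with $n$ crossings, labeled $1,\dots,n$ in some order. At each crossing, draw on the over-strand an arrow pointing along the knot in an arbitrarily chosen one of the two directions, and draw on the under-strand an arrow along the knot pointing in the direction obtained by turning counterclockwise from the over-crossing arrow. The trip matrix is the $n\times n$ matrix $T$ over $\mathbb{Z}_2$ (the field with two elements) defined as follows. (1) Diagonal entries: start on the over-strand at crossing $i$ and travel along the knot in the direction of the over-crossing arrow until first returning to crossing $i$ (on its under-strand). Set $T_{ii}=0$ if the under-crossing arrow points in the current direction of travel, and $T_{ii}=1$ if it points in the opposite direction. (2) Off-diagonal entries, $i\ne j$: start on the over-strand at crossing $j$ and travel along the knot in the direction of the over-crossing arrow until first returning to crossing $j$. $T_{ij}$ is the number, modulo $2$, of times crossing $i$ is passed through (on either strand) during this trip. The matrix $T$ does not depend on the choices of over-crossing arrow directions and is symmetric. A trip matrix of a knot $K$ is the trip matrix of some labeled diagram of $K$. A block diagonal matrix is a square matrix formed by placing smaller square matrices $A_1,\dots,A_m$ along the diagonal, with zeros in all remaining entries; the $A_i$ are its blocks. *)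

(* Defs.v *)
From HB Require Import structures.
From mathcomp Require Import all_boot all_order all_algebra.
From mathcomp Require Import all_classical all_reals all_analysis.

Set Implicit Arguments.
Unset Strict Implicit.
Unset Printing Implicit Defensive.

Import Order.TTheory GRing.Theory Num.Theory.
Import numFieldNormedType.Exports.

Local Open Scope classical_set_scope.
Local Open Scope ring_scope.

(* Knots are tame knots in R^3 (unoriented), up to ambient isotopy. *)

Definition homeomorphism (T : topologicalType) (f : T -> T) : Prop :=
  continuous f /\ exists g : T -> T, [/\ continuous g, cancel f g & cancel g f].

Definition ambient_isotopic (R : realType) (K L : set 'rV[R]_3) : Prop :=
  exists H : R -> 'rV[R]_3 -> 'rV[R]_3,
  [/\ {within `[0, 1]%classic `*` [set: 'rV[R]_3],
        continuous (fun p : R * 'rV[R]_3 => H p.1 p.2)},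
      forall t : R, 0 <= t <= 1 -> homeomorphism (H t),
      forall x, H 0 x = x
    & H 1 @` K = L].

(* The closed polygon with vertices P_0, ..., P_(m-1) is parametrized by
   [0, m): for 0 <= s < 1, the parameter i + s is the point
   (1 - s) P_i + s P_(i+1), the indices being taken modulo m. *)
Definition polygon (R : realType) : Type := seq 'rV[R]_3.

Definition params (R : realType) (P : polygon R) : interval R :=
  `[0, (size P)%:R[.

Definition next_vertex (R : realType) (P : polygon R) (i : nat) : 'rV[R]_3 :=
  P`_(i.+1 %% size P)%N.

Definition point (R : realType) (P : polygon R) (t : R) : 'rV[R]_3 :=
  let i := Num.truncn t in
  let s := t - i%:R in
  (1 - s) *: P`_i + s *: next_vertex P i.

Definition edge (R : realType) (P : polygon R) (t : R) : 'rV[R]_3 :=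
  let i := Num.truncn t in next_vertex P i - P`_i.

Definition trace (R : realType) (P : polygon R) : set 'rV[R]_3 :=
  point P @` [set` params P].

Definition simple_polygon (R : realType) (P : polygon R) : Prop :=
  (2 < size P)%N /\ {in params P &, injective (point P)}.

Definition knot (R : realType) (K : set 'rV[R]_3) : Prop :=
  exists P : polygon R, simple_polygon P /\ ambient_isotopic (trace P) K.

Definition unit_circle (R : realType) : set 'rV[R]_3 :=
  [set x | x 0 0 ^+ 2 + x 0 1 ^+ 2 = 1 /\ x 0 2 = 0].

Definition trivial_knot (R : realType) (K : set 'rV[R]_3) : Prop :=
  ambient_isotopic (@unit_circle R) K.

(* Diagrams are regular vertical projections to the first two coordinates,
   seen from above: at a crossing the over-strand has the larger third
   coordinate, and [turn v w > 0] means that the shadow of w is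
   counterclockwise from the shadow of v. *)
Definition shadow (R : realType) (x : 'rV[R]_3) : R * R := (x 0 0, x 0 1).

Definition height (R : realType) (x : 'rV[R]_3) : R := x 0 2.

Definition turn (R : realType) (v w : 'rV[R]_3) : R :=
  v 0 0 * w 0 1 - v 0 1 * w 0 0.

Definition double_point (R : realType) (P : polygon R) (s t : R) : Prop :=
  [/\ s \in params P, t \in params P, s <> t
    & shadow (point P s) = shadow (point P t)].

Definition regular (R : realType) (P : polygon R) : Prop :=
  [/\ (forall r s t, double_point P r s -> double_point P r t -> s = t),
      (forall s t, double_point P s t -> s <> (Num.truncn s)%:R)
    & (forall s t, double_point P s t -> turn (edge P s) (edge P t) <> 0)].

Definition diagram (R : realType) (P : polygon R) : Prop :=
  simple_polygon P /\ regular P.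

Definition diagram_of (R : realType) (P : polygon R) (K : set 'rV[R]_3) :
    Prop :=
  diagram P /\ ambient_isotopic (trace P) K.

(* A crossing is the pair (over, under) of its two parameters. *)
Definition crossings (R : realType) (P : polygon R) : set (R * R) :=
  [set x | double_point P x.1 x.2 /\
           height (point P x.2) < height (point P x.1)].

Definition labeling (R : realType) (P : polygon R) (n : nat)
    (c : 'I_n -> R * R) : Prop :=
  set_bij [set: 'I_n] (crossings P) c.

(* [t] is met strictly between [a] and [b] when travelling from [a] to [b] in
   the direction of increasing parameter (cyclically). *)
Definition met_between (R : realType) (a b t : R) : bool :=
  if a < b then a < t < b else (a < t) || (t < b).

(* Choices of over-crossing arrows are maps d : 'I_n -> bool; [true] is the
   direction of increasing parameter. *)
Definition directed (R : realType) (d : bool) (v : 'rV[R]_3) : 'rV[R]_3 :=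
  if d then v else - v.

Definition under_arrow (R : realType) (over_arrow v : 'rV[R]_3) : 'rV[R]_3 :=
  if 0 < turn over_arrow v then v else - v.

Definition trip_meets (R : realType) (d : bool) (x : R * R) (t : R) : bool :=
  if d then met_between x.1 x.2 t else met_between x.2 x.1 t.

Definition trip_mx (R : realType) (P : polygon R) (n : nat)
    (c : 'I_n -> R * R) (d : 'I_n -> bool) : 'M['F_2]_n :=
  \matrix_(i, j)
    if i == j then
      let over_arrow := directed (d i) (edge P (c i).1) in
      let travel := directed (d i) (edge P (c i).2) in
      if under_arrow over_arrow (edge P (c i).2) == travel then 0 else 1
    else
      (trip_meets (d j) (c j) (c i).1 + trip_meets (d j) (c j) (c i).2)%N%:R.

Definition trip_matrix_of (R : realType) (K : set 'rV[R]_3) (n : nat)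
    (T : 'M['F_2]_n) : Prop :=
  exists (P : polygon R) (c : 'I_n -> R * R),
  [/\ diagram_of P K, labeling P c
    & forall d : 'I_n -> bool, T = trip_mx P c d].

Definition uncrossed (R : realType) (P : polygon R) (i : nat) : Prop :=
  forall s t, double_point P s t -> Num.truncn s <> i.

(* D is a composition of the diagrams P and Q, whose shadows do not overlap:
   an edge without crossings is removed from each of them, and the endpoints
   are joined by two new edges without crossings. With A and B the rotations
   of P and Q whose last (closing) edges are the removed ones, the new edges
   of A ++ B are those with index (size A).-1 and (size (A ++ B)).-1. *)
Definition composition (R : realType) (P Q D : polygon R) : Prop :=
  [/\ diagram P, diagram Q & diagram D] /\
  (@shadow R @` trace P) `&` (@shadow R @` trace Q) = set0 /\
  exists k l : nat,
  let A := rot k P in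
  let B := rot l Q in
  [/\ D = A ++ B, uncrossed A (size A).-1, uncrossed B (size B).-1,
      uncrossed D (size A).-1 & uncrossed D (size D).-1].

Inductive iterated_composition (R : realType) :
    seq (polygon R) -> polygon R -> Prop :=
| Composition1 P : iterated_composition [:: P] P
| CompositionS P Ps Q D :
    iterated_composition Ps Q -> composition P Q D ->
    iterated_composition (P :: Ps) D.

(* K = K_0 # ... # K_(n-1). Both ways of connecting two unoriented knots are
   allowed, since each diagram of a knot can be traversed in reverse. *)
Definition connected_sum (R : realType) (n : nat) (Ks : 'I_n -> set 'rV[R]_3)
    (K : set 'rV[R]_3) : Prop :=
  exists (Ps : 'I_n -> polygon R) (D : polygon R),
  [/\ forall j, diagram_of (Ps j) (Ks j),
      iterated_composition [seq Ps j | j <- enum 'I_n] D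
    & diagram_of D K].

Definition prime_knot (R : realType) (K : set 'rV[R]_3) : Prop :=
  [/\ knot K, ~ trivial_knot K
    & forall Ks : 'I_2 -> set 'rV[R]_3,
        connected_sum Ks K -> exists j, trivial_knot (Ks j)].

(* Main.v *)
Require Import Defs.
From mathcomp Require Import all_boot all_order all_algebra zify ring lra.
From mathcomp Require Import all_classical all_reals all_analysis.

Set Implicit Arguments.
Unset Strict Implicit.
Unset Printing Implicit Defensive.

Import Order.TTheory GRing.Theory Num.Theory.
Import numFieldNormedType.Exports.
Local Open Scope classical_set_scope.
Local Open Scope ring_scope.

(** The block structure is already visible in the diagram [D] that witnesses
    the connected sum.  When [D] is obtained from two diagrams with disjoint
    shadows by replacing a crossingless edge of each with two crossingless
    connecting edges, no crossing is created or lost: every crossing of [D]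
    lies within one summand.  The knot [D] runs through all crossings of the
    first summand, then through all those of the second, and in each of them
    it keeps the height, the edge directions and the cyclic order of the
    crossing parameters.

    Every entry of a trip matrix depends on these data only.  A diagonal entry
    records the sign of the turn from the over-edge to the under-edge, and an
    off-diagonal entry counts how many of the two parameters of a crossing lie
    on a cyclic arc between the two parameters of another.  Hence two crossings
    of the same summand have the same entry in [D] as in the summand.  For
    crossings of different summands, a trip starting in one summand either runs
    through the whole of the other or misses it, so it meets both parameters of
    the other crossing or neither, and the entry is 0 modulo 2.

    [splits Ps D g] expresses this decomposition, [g i] being the change of
    parameter from the [i]-th summand to [D].  It holds for an iterated
    composition by induction, from its stability under moving the base point
    of a diagram ([splits_rot]) and from the case of a single concatenation
    ([splits_cat], [splits_cons]).  Labelings of the summands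
    ([labeling_exists]) are then put together into one of [D]
    ([labeling_joint]), whose trip matrix is block diagonal
    ([trip_mx_joint]).  Finally [trip_mx_direction] shows that the choice of
    over-crossing arrows is immaterial. *)

(* [point] alone denotes the base point of a pointed type. *)
Local Notation point := Defs.point.

Lemma nth_rot_modn (T : Type) (x : T) (s : seq T) k i :
  (k <= size s)%N -> (i < size s)%N ->
  nth x (rot k s) i = nth x s ((i + k) %% size s).
Proof.
move=> ks si; rewrite /rot nth_cat size_drop nth_drop ltn_subRL.
case: ltnP => [lt|ge]; first by rewrite [(i + k)%N]addnC modn_small.
have -> : (i + k)%N = (i - (size s - k) + size s)%N by lia.
by rewrite modnDr modn_small ?nth_take //; lia.
Qed.

(** * Changes of parameter that preserve crossings *)

Section Reparametrization.
Variable R : realType.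
Implicit Types (P Q A B D : polygon R) (Ps : seq (polygon R)).
Implicit Types (s t a b : R).

Lemma in_params P t : (t \in params P) = (0 <= t < (size P)%:R).
Proof. by rewrite in_itv. Qed.

Lemma truncnDn t k : 0 <= t -> Num.truncn (t + k%:R) = (Num.truncn t + k)%N.
Proof.
move=> t0; have /andP[lt ut] := truncn_itv t0.
by apply: truncn_def; rewrite natrD -addSn natrD lerD2r lt ltrD2r ut.
Qed.

Lemma truncnBn t k :
  k%:R <= t -> Num.truncn (t - k%:R) = (Num.truncn t - k)%N.
Proof.
move=> kt; rewrite -[in RHS](subrK k%:R t) truncnDn ?subr_ge0 //.
by rewrite addnK.
Qed.

Lemma truncn_params P t : t \in params P -> (Num.truncn t < size P)%N.
Proof. by rewrite in_params => /andP[t0 tP]; rewrite truncn_lt_nat. Qed.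

Definition same_strand P D s s' : Prop :=
  [/\ s' \in params D, point D s' = point P s & edge D s' = edge P s].

(** Arcs rather than inequalities: moving the base point of a closed polygon
    breaks the order of the parameters but keeps their cyclic order. *)
Definition cyclic_mono (S : set R) (g : R -> R) : Prop :=
  forall a b t, S a -> S b -> S t ->
    met_between (g a) (g b) (g t) = met_between a b t.

Definition crossed P : set R := [set s | exists t, double_point P s t].

(** Only the crossed parameters are constrained: the removed edge of a summand
    survives nowhere in the composition, but it carries no crossing. *)
Definition embeds P D (g : R -> R) : Prop :=
  (forall s, crossed P s -> same_strand P D s (g s)) /\
  cyclic_mono (crossed P) g.

Lemma met_betweenxx a t : met_between a a t = (t != a).
Proof. by rewrite /met_between ltxx neq_lt orbC. Qed.

Lemma met_between_right a b t : a < t -> b < t ->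
  met_between a b t = ~~ (a < b).
Proof.
move=> at_ bt; rewrite /met_between at_ (lt_gtF bt).
by case: ltP.
Qed.

Lemma met_between_left a b t : t < a -> t < b ->
  met_between a b t = ~~ (a < b).
Proof.
move=> ta tb; rewrite /met_between tb (lt_gtF ta).
by case: ltP.
Qed.

(** The arc from [a] to itself meets everything but [a], so preserving arcs
    entails injectivity. *)
Lemma cyclic_mono_inj S g a b :
  cyclic_mono S g -> S a -> S b -> g a = g b -> a = b.
Proof.
move=> gS Sa Sb gab; have := gS a a b Sa Sa Sb.
by rewrite !met_betweenxx gab eqxx => /esym/negbFE/eqP.
Qed.

Lemma double_pointC P s t : double_point P s t -> double_point P t s.
Proof. by case=> sP tP st e; split=> // /esym. Qed.

Lemma crossedl P s t : double_point P s t -> crossed P s.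
Proof. by move=> st; exists t. Qed.

Lemma crossedr P s t : double_point P s t -> crossed P t.
Proof. by move=> /double_pointC; exact: crossedl. Qed.

Lemma embeds_double_point P D g s t :
  embeds P D g -> double_point P s t -> double_point D (g s) (g t).
Proof.
move=> [gs gm] st; have [_ _ ne e] := st.
have cs := crossedl st; have ct := crossedr st.
have [gsD ps _] := gs _ cs; have [gtD pt _] := gs _ ct.
by split; rewrite ?ps ?pt // => /(cyclic_mono_inj gm cs ct).
Qed.

Lemma embeds_crossed P D g s : embeds P D g -> crossed P s -> crossed D (g s).
Proof. by move=> gE [t /(embeds_double_point gE)]; exists (g t). Qed.

Lemma embeds_comp P Q D g h :
  embeds P Q g -> embeds Q D h -> embeds P D (h \o g).
Proof.
move=> gE hE; have cg := embeds_crossed gE.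
case: gE => gs gm; case: hE => hs hm; split=> [s Ps|a b t Pa Pb Pt] /=.
  have [_ p e] := gs _ Ps; have [? hp he] := hs _ (cg _ Ps).
  by split; rewrite ?hp ?he.
by rewrite hm ?gm //; exact: cg.
Qed.

(** * Decomposition of the crossings of a polygon *)

Definition unlinked (S T : set R) : Prop :=
  forall a b s t, S a -> S b -> T s -> T t ->
    met_between a b s = met_between a b t.

Definition splits Ps D (g : nat -> R -> R) : Prop :=
  let P i := nth [::] Ps i in
  [/\ forall i, (i < size Ps)%N -> embeds (P i) D (g i),
      forall i j, (i < size Ps)%N -> (j < size Ps)%N -> i <> j ->
        unlinked (g i @` crossed (P i)) (g j @` crossed (P j))
    & forall s t, double_point D s t ->
        exists2 i, (i < size Ps)%N &
        exists s' t', [/\ double_point (P i) s' t', s = g i s' & t = g i t']].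

Lemma splits1 P : splits [:: P] P (fun=> id).
Proof.
split=> [[|i] //= _|[|i] [|j] //|s t st].
  by split=> // s [t [sP tP _ _]].
by exists 0%N => //; exists s, t.
Qed.

(** Splitting is transitive: the summands of [B] are unlinked from [A] because
    their crossed parameters land among those of [B]. *)
Lemma splits_cons P Q Ps A B D g f h :
  splits [:: A; B] D g -> splits [:: P] A f -> splits Ps B h ->
  splits (P :: Ps) D (fun i => if i is j.+1 then g 1%N \o h j else g 0%N \o f 0%N).
Proof.
move=> [gE gU gC] [fE fU fC] [hE hU hC].
have g0E := gE 0%N isT; have g1E := gE 1%N isT; have f0E := fE 0%N isT.
have sub0 : (g 0%N \o f 0%N) @` crossed P `<=` g 0%N @` crossed A.
  by move=> _ [s Ps' <-]; exists (f 0%N s) => //; exact: embeds_crossed f0E Ps'.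
have sub1 j : (j < size Ps)%N ->
    (g 1%N \o h j) @` crossed (nth [::] Ps j) `<=` g 1%N @` crossed B.
  move=> jP _ [s Ps' <-]; exists (h j s) => //.
  exact: embeds_crossed (hE j jP) Ps'.
split=> [[|i] /= iP|[|i] [|j] //= iP jP ij|s t st].
- exact: embeds_comp f0E g0E.
- exact: embeds_comp (hE i iP) g1E.
- move=> a b s t /sub0 ? /sub0 ? /(sub1 _ jP) ? /(sub1 _ jP) ?.
  by apply: (gU 0%N 1%N).
- move=> a b s t /(sub1 _ iP) ? /(sub1 _ iP) ? /sub0 ? /sub0 ?.
  by apply: (gU 1%N 0%N).
- move=> _ _ _ _ [a Pa <-] [b Pb <-] [s Ps' <-] [t Pt <-] /=.
  have iP' : (i < size Ps)%N := iP; have jP' : (j < size Ps)%N := jP.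
  have hc k x : (k < size Ps)%N -> crossed (nth [::] Ps k) x -> crossed B (h k x).
    by move=> kP; exact: embeds_crossed (hE k kP).
  have := (hc _ _ iP' Pa, hc _ _ iP' Pb, hc _ _ jP' Ps', hc _ _ jP' Pt).
  move=> [[[? ?] ?] ?]; have [_ g1m] := g1E.
  rewrite !g1m //.
  by apply: (hU i j iP' jP'); [move=> e; apply: ij; rewrite e|exists a|exists b|exists s|exists t].
- have [[|[|//]] _ [s' [t' [st' -> ->]]]] := gC s t st.
    have [[|//] _ [s'' [t'' [st'' -> ->]]]] := fC s' t' st'.
    by exists 0%N => //; exists s'', t''.
  have [i iP [s'' [t'' [st'' -> ->]]]] := hC s' t' st'.
  by exists i.+1 => //; exists s'', t''.
Qed.

(** * Moving the base point *)

(** The parameter change from a polygon of [m] vertices to its rotation by [k]: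
    [t - k] modulo [m]. *)
Definition rotate (m k t : R) : R := if t < k then t + (m - k) else t - k.

(** A rotation reverses the order of two parameters exactly when they are
    separated by the new base point. *)
Lemma ltr_rotate (m k a b : R) : 0 <= a < m -> 0 <= b < m ->
  (rotate m k a < rotate m k b) = (a < b) (+) ((a < k) (+) (b < k)).
Proof.
move=> /andP[a0 am] /andP[b0 bm]; rewrite /rotate.
case: (ltP a k) => ak; case: (ltP b k) => bk; rewrite ?ltrD2r ?addbF //=.
  by case: (ltP a b) => ?; case: ltP => ? //=; lra.
by case: (ltP a b) => ?; case: ltP => ? //=; lra.
Qed.

Lemma cyclic_mono_rotate (m k : R) :
  cyclic_mono [set t | 0 <= t < m] (rotate m k).
Proof.
move=> a b t /= am bm tm; rewrite /met_between !ltr_rotate //.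
case: (ltP a k) => ?; case: (ltP b k) => ?; case: (ltP t k) => ?;
  case: (ltP a b) => ?; case: (ltP a t) => ?; case: (ltP t b) => ? //=; lra.
Qed.

Lemma rotate_same_strand P k t : (k <= size P)%N -> t \in params P ->
  same_strand P (rot k P) t (rotate (size P)%:R k%:R t).
Proof.
move=> kP tP; have iP := truncn_params tP.
move: (tP); rewrite in_params => /andP[t0 tm].
have kR : k%:R <= (size P)%:R :> R by rewrite ler_nat.
have k0 : 0 <= k%:R :> R by [].
set m := size P in iP tm kP kR *; set i := Num.truncn t in iP *.
set t' := rotate _ _ _.
have t'P : t' \in params (rot k P).
  by rewrite in_params size_rot -/m /t' /rotate; case: ltP => ?; lra.
(* [j] is the vertex of the rotated polygon that corresponds to [i]. *)
have [j [ij jP jk]] : exists j, [/\ Num.truncn t' = j, (j < m)%N &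
    (j + k = i %[mod m])%N /\ t' - j%:R = t - i%:R].
  have [lt|ge] := ltP t k%:R.
    exists (i + (m - k))%N; rewrite /t' /rotate lt -natrB // truncnDn //.
    have := lt; rewrite -truncn_lt_nat // -/i => ik.
    split=> //; first by lia.
    split; last by rewrite natrD; ring.
    by rewrite -addnA subnK // modnDr.
  exists (i - k)%N; rewrite /t' /rotate ltNge ge /= truncnBn // -/i.
  have := ge; rewrite -truncn_ge_nat // -/i => ik.
  split=> //; first by lia.
  by split; [rewrite subnK | rewrite natrB //; ring].
case: jk => jk fr.
have nP : (rot k P)`_j = P`_i by rewrite nth_rot_modn // jk modn_small.
have nxt : next_vertex (rot k P) j = next_vertex P i.
  rewrite /next_vertex size_rot -/m nth_rot_modn //; last first.
    by rewrite ltn_mod; exact: leq_ltn_trans iP.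
  congr (nth _ _ _); rewrite -/m modnDml addSn.
  by rewrite -[in LHS]addn1 -modnDml jk modnDml addn1.
by split=> //; rewrite /point /edge ij nP nxt ?fr.
Qed.

Lemma rotate_surj P k s : (k <= size P)%N -> s \in params (rot k P) ->
  exists2 t, t \in params P & rotate (size P)%:R k%:R t = s.
Proof.
move=> kP; rewrite in_params size_rot => /andP[s0 sm].
have kR : k%:R <= (size P)%:R :> R by rewrite ler_nat.
have k0 : 0 <= k%:R :> R by [].
have [lt|ge] := ltP s ((size P)%:R - k%:R).
  by exists (s + k%:R); rewrite ?in_params /rotate; [lra|case: ltP => ?; lra].
exists (s + k%:R - (size P)%:R); rewrite ?in_params /rotate; [lra|].
by case: ltP => ?; lra.
Qed.

(** Allowing any [k], since [rot] is the identity beyond the size. *)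
Lemma rot_reparam P k : exists g,
  [/\ {in params P, forall t, same_strand P (rot k P) t (g t)},
      cyclic_mono [set` params P] g
    & {in params (rot k P), forall s, exists2 t, t \in params P & g t = s}].
Proof.
have [kP|/ltnW kP] := leqP k (size P); last first.
  by rewrite rot_oversize //; exists id; split=> // s sP; exists s.
exists (rotate (size P)%:R k%:R); split=> [t tP|a b t /=|s sP].
- exact: rotate_same_strand.
- by rewrite !in_params; exact: cyclic_mono_rotate.
- exact: rotate_surj.
Qed.

Lemma trace_rot P k : trace (rot k P) = trace P.
Proof.
have [g [gs _ gsurj]] := rot_reparam P k.
apply/seteqP; split=> [_ [s /gsurj [t tP <-] <-]|_ [t tP <-]].
  by have [_ -> _] := gs t tP; exists t.
by have [gP <- _] := gs t tP; exists (g t).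
Qed.

Lemma splits_rot Ps P k g :
  splits Ps P g -> exists h, splits Ps (rot k P) h.
Proof.
move=> [gE gU gC]; have [f [fs fm fsurj]] := rot_reparam P k.
have cP s : crossed P s -> s \in params P by case=> t [].
have fE : embeds P (rot k P) f.
  by split=> [s /cP|a b t /cP aP /cP bP /cP tP]; [exact: fs | exact: fm].
exists (fun i => f \o g i); split=> [i iP|i j iP jP ij|s t [sP tP st e]].
- exact: embeds_comp (gE i iP) fE.
- have gc l x : (l < size Ps)%N -> crossed (nth [::] Ps l) x ->
      g l x \in params P.
    by move=> lP xc; apply: cP; exact: embeds_crossed (gE l lP) xc.
  move=> _ _ _ _ [a aP <-] [b bP <-] [s sP <-] [t tP <-] /=.
  rewrite !fm /=; try exact: gc.
  by apply: (gU i j).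
have [s' s'P es] := fsurj s sP; have [t' t'P et] := fsurj t tP.
have st' : double_point P s' t'.
  split=> //; first by move=> E; apply: st; rewrite -es E.
  have [_ <- _] := fs s' s'P; have [_ <- _] := fs t' t'P.
  by rewrite es et.
have [i iP [s'' [t'' [st'' es' et']]]] := gC s' t' st'.
by exists i => //; exists s'', t''; split=> //=; rewrite -?es' -?et'.
Qed.

(** * Concatenation of diagrams with disjoint shadows *)

(** The closing edge of [A] is the one edge of [A] that is not an edge of
    [A ++ B], whence the bound on the edge of [t]. *)
Lemma catl_same_strand A B t : t \in params A ->
  ((Num.truncn t).+1 < size A)%N -> same_strand A (A ++ B) t t.
Proof.
rewrite in_params => /andP[t0 tA] iA.
have iA' := ltnW iA.
have eN : next_vertex (A ++ B) (Num.truncn t) = next_vertex A (Num.truncn t).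
  by rewrite /next_vertex size_cat !modn_small ?nth_cat ?iA ?ltn_addr.
split; rewrite /point /edge ?eN ?nth_cat ?iA' //.
by rewrite in_params size_cat t0 natrD (lt_le_trans tA) // lerDl.
Qed.

Lemma catr_same_strand A B t : t \in params B ->
  ((Num.truncn t).+1 < size B)%N -> same_strand B (A ++ B) t (t + (size A)%:R).
Proof.
rewrite in_params => /andP[t0 tB] iB.
have eN : next_vertex (A ++ B) (Num.truncn t + size A)
          = next_vertex B (Num.truncn t).
  rewrite /next_vertex size_cat !modn_small ?nth_cat; try lia.
  by rewrite -addSn ltnNge leq_addl addnK.
have eV : (A ++ B)`_(Num.truncn t + size A) = B`_(Num.truncn t).
  by rewrite nth_cat ltnNge leq_addl addnK.
split; rewrite /point /edge ?truncnDn // ?eN ?eV //.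
  by rewrite in_params size_cat natrD [_%:R + _]addrC ltrD2r tB addr_ge0.
by congr ((1 - _) *: _ + _ *: _); rewrite natrD; ring.
Qed.

Lemma crossed_truncn P s : uncrossed P (size P).-1 -> crossed P s ->
  s \in params P /\ ((Num.truncn s).+1 < size P)%N.
Proof.
move=> uP [t st]; have [sP _ _ _] := st; split=> //.
have := truncn_params sP; have := uP s t st; lia.
Qed.

(** A double point of [A ++ B] avoids the two connecting edges, so each of its
    parameters comes from [A] or from [B]; both come from the same polygon
    because the shadows are disjoint.  The summands are unlinked since all the
    parameters of [A] precede those of [B]. *)
Lemma splits_cat A B :
  (@shadow R @` trace A) `&` (@shadow R @` trace B) = set0 ->
  uncrossed A (size A).-1 -> uncrossed B (size B).-1 ->
  uncrossed (A ++ B) (size A).-1 -> uncrossed (A ++ B) (size (A ++ B)).-1 ->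
  exists g, splits [:: A; B] (A ++ B) g.
Proof.
move=> AB0 uA uB uD1 uD2; set M : R := (size A)%:R.
have ltA s : s \in params A -> s < M by rewrite in_params => /andP[].
have ge0 P s : s \in params P -> 0 <= s by rewrite in_params => /andP[].
have loc s t : double_point (A ++ B) s t ->
    same_strand A (A ++ B) s s /\ s \in params A \/
    exists2 s', s = s' + M & same_strand B (A ++ B) s' s /\ s' \in params B.
  move=> st; have [sD _ _ _] := st; have n1 := uD1 _ _ st; have n2 := uD2 _ _ st.
  have := truncn_params sD; rewrite size_cat => iD.
  move: sD n2; rewrite in_params size_cat natrD -/M => /andP[s0 sD] n2.
  have [sM|Ms] := ltP s M.
    have sA : s \in params A by rewrite in_params s0.
    by left; split=> //; apply: catl_same_strand => //; have := truncn_params sA; lia.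
  have sB : s - M \in params B by rewrite in_params; lra.
  right; exists (s - M); first by rewrite subrK.
  split=> //; rewrite -[X in same_strand _ _ _ X](subrK M).
  apply: catr_same_strand => //; have := truncn_params sB.
  rewrite truncnBn //; have := truncn_ge_nat (size A) s0; rewrite Ms; lia.
have sep s t : s \in params A -> t \in params B ->
    shadow (point A s) <> shadow (point B t).
  move=> sA tB e; suff: set0 (shadow (point A s)) by [].
  rewrite -AB0; split; first by exists (point A s) => //; exists s.
  by rewrite e; exists (point B t) => //; exists t.
have sepM a s : crossed A a -> crossed B s -> a < s + M.
  move=> /(crossed_truncn uA)[/ltA aM _] /(crossed_truncn uB)[/ge0 s0 _].
  by rewrite (lt_le_trans aM) // lerDr.
exists (fun i => if i is 0 then id else fun t => t + M).
split=> [[|[|//]] /= _|[|[|//]] [|[|//]] //= _ _ _|s t st].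
- split=> // s /(crossed_truncn uA)[]; exact: catl_same_strand.
- split=> [s /(crossed_truncn uB)[]|a b t _ _ _]; first exact: catr_same_strand.
  by rewrite /met_between !ltrD2r.
- move=> _ _ _ _ [a aA <-] [b bA <-] [s sB <-] [t tB <-].
  by rewrite !met_between_right; do ?[exact: sepM].
- move=> _ _ _ _ [s sB <-] [t tB <-] [a aA <-] [b bA <-].
  by rewrite !met_between_left; do ?[exact: sepM].
- have [_ _ ne e] := st.
  case: (loc s t st) => [[[_ es _] sA]|[s' ss [[_ es _] sB]]];
  case: (loc t s (double_pointC st)) => [[[_ et _] tA]|[t' tt [[_ et _] tB]]].
  + by exists 0%N => //=; exists s, t; split=> //; split=> //; rewrite -es -et.
  + by case: (sep s t' sA tB); rewrite -es -et.
  + by case: (sep t s' tA sB); rewrite -es -et.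
  + exists 1%N => //=; exists s', t'; split=> //.
    by split; rewrite -?es -?et // => E; apply: ne; rewrite ss tt E.
Qed.

Lemma splits_composition P Q Ps D h :
  composition P Q D -> splits Ps Q h -> exists g, splits (P :: Ps) D g.
Proof.
move=> [_ [PQ0 [k [l [-> uA uB uD1 uD2]]]]] hS.
have [f fS] := splits_rot k (splits1 P); have [h' hS'] := splits_rot l hS.
have [g gS] : exists g, splits [:: rot k P; rot l Q] (rot k P ++ rot l Q) g.
  by apply: splits_cat => //; rewrite !trace_rot.
by eexists; exact: splits_cons gS fS hS'.
Qed.

Lemma splits_iterated_composition Ps D :
  iterated_composition Ps D -> exists g, splits Ps D g.
Proof.
elim=> [P|P {}Ps Q {}D _ [h hS] PQD]; first by exists (fun=> id); exact: splits1.
exact: splits_composition hS.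
Qed.

(** * Labelings and independence of the arrows *)

Lemma turnNl (v w : 'rV[R]_3) : turn (- v) w = - turn v w.
Proof. by rewrite /turn !mxE; ring. Qed.

Lemma shadow_point P s : shadow (point P s) =
  (P`_(Num.truncn s) 0 0 + (s - (Num.truncn s)%:R) * edge P s 0 0,
   P`_(Num.truncn s) 0 1 + (s - (Num.truncn s)%:R) * edge P s 0 1).
Proof. by rewrite /shadow /point /edge !mxE; congr pair; ring. Qed.

(** Two transverse segments cross at most once: the difference of two solutions
    satisfies a homogeneous linear system whose determinant is the turn. *)
Lemma double_point_determined P s t s' t' : regular P ->
  double_point P s t -> double_point P s' t' ->
  Num.truncn s = Num.truncn s' -> Num.truncn t = Num.truncn t' ->
  (s, t) = (s', t').
Proof.
move=> [_ _ tr] st st' es et; have /eqP nz := tr s t st.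
have [_ _ _] := st; have [_ _ _] := st'.
have eds : edge P s' = edge P s by rewrite /edge es.
have edt : edge P t' = edge P t by rewrite /edge et.
rewrite !shadow_point eds edt -es -et.
move: nz; rewrite /turn; set x0 := edge P s 0 0; set x1 := edge P s 0 1.
set y0 := edge P t 0 0; set y1 := edge P t 0 1 => nz [e0' e1'] [e0 e1].
have H0 : (s - s') * x0 = (t - t') * y0 by lra.
have H1 : (s - s') * x1 = (t - t') * y1 by lra.
(* Cramer's rule. *)
have Hs : (s - s') * (x0 * y1 - x1 * y0) = 0.
  transitivity ((s - s') * x0 * y1 - (s - s') * x1 * y0); first by ring.
  by rewrite H0 H1; ring.
have Ht : (t - t') * (x0 * y1 - x1 * y0) = 0.
  transitivity (x0 * ((t - t') * y1) - x1 * ((t - t') * y0)); first by ring.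
  by rewrite -H0 -H1; ring.
move/eqP: Hs; move/eqP: Ht.
by rewrite !mulf_eq0 (negPf nz) !orbF !subr_eq0 => /eqP -> /eqP ->.
Qed.

(** A crossing is determined by the pair of edges on which it lies. *)
Lemma finite_crossings P : regular P -> finite_set (crossings P).
Proof.
move=> rP; pose f (x : R * R) := (Num.truncn x.1, Num.truncn x.2).
have fI : {in crossings P &, injective f}.
  move=> [s t] [s' t'] /set_mem[st _] /set_mem[st' _] [].
  exact: double_point_determined rP st st'.
rewrite -(eq_finite_set (inj_card_eq fI)).
apply: (@sub_finite_set _ _ (`I_(size P) `*` `I_(size P))).
  by move=> _ [x [[xP yP _ _] _] <-]; split; exact: truncn_params.
exact: finite_setX.
Qed.

Lemma labeling_exists P : regular P ->
  exists (n : nat) (c : 'I_n -> R * R), labeling P c.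
Proof.
move=> /finite_crossings/finite_setP[n Pn]; exists n.
have : ([set: 'I_n] #= crossings P)%card.
  by rewrite card_eq_sym (card_eq_trans Pn) ?card_II.
by case/card_set_bijP => c cP; exists c.
Qed.

(** The absence of triple points makes each parameter of a crossing determine
    the other one, and the heights tell the over-strand from the under-strand. *)
Lemma crossings_apart P (x y : R * R) : regular P ->
  crossings P x -> crossings P y -> x <> y ->
  [/\ x.1 <> y.1, x.1 <> y.2, x.2 <> y.1 & x.2 <> y.2].
Proof.
case: x y => [s t] [s' t'] [inv _ _] [/= st hst] [/= st' hst'] ne.
have ts := double_pointC st; have ts' := double_pointC st'.
split=> /= E; subst.
- by apply: ne; rewrite (inv _ _ _ st st').
- by move: hst hst'; rewrite (inv _ _ _ st ts') => /lt_trans/[apply]; rewrite ltxx.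
- by move: hst hst'; rewrite (inv _ _ _ ts st') => /lt_trans/[apply]; rewrite ltxx.
- by apply: ne; rewrite (inv _ _ _ ts ts').
Qed.

Lemma met_betweenC (a b t : R) : a <> b -> t <> a -> t <> b ->
  met_between b a t = ~~ met_between a b t.
Proof.
move=> /eqP ab /eqP ta /eqP tb; rewrite /met_between.
by case: ltgtP ab => //; case: ltgtP ta => //; case: ltgtP tb => //=; lra.
Qed.

(** Reversing the over-crossing arrow reverses both the under-crossing arrow and
    the direction of travel, so their agreement is the sign of the crossing. *)
Lemma under_arrow_travel (d : bool) (v w : 'rV[R]_3) : turn v w <> 0 ->
  (under_arrow (directed d v) w == directed d w) = (0 < turn v w).
Proof.
move=> /eqP nz.
have wN : (w == - w) = false.
  apply/eqP => e; case/eqP: nz.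
  have w0 i : w 0 i = 0 by have := congr1 (fun u : 'rV[R]_3 => u 0 i) e; rewrite mxE; lra.
  by rewrite /turn !w0 !mulr0 subrr.
case: d; rewrite /under_arrow /directed ?turnNl ?oppr_gt0.
  by case: ifP; rewrite ?eqxx // eq_sym wN.
by case: ltgtP nz; rewrite ?eqxx ?wN.
Qed.

(** Off the diagonal, the two trips starting at a crossing [j] are complementary
    arcs: together they meet another crossing twice, so their counts have the
    same parity. *)
Lemma trip_mx_direction P n (c : 'I_n -> R * R) d d' :
  regular P -> labeling P c -> trip_mx P c d = trip_mx P c d'.
Proof.
move=> rP [cP cI _]; apply/matrixP => i j; rewrite !mxE.
have cr k : crossings P (c k) by exact: cP.
have [_|/eqP ij] := eqVneq i j.
  have [_ _ tr] := rP; have [st _] := cr i.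
  by rewrite /= !under_arrow_travel //; exact: tr.
have [] := crossings_apart rP (cr i) (cr j).
  by move=> /cI e; apply: ij; apply: e; rewrite inE.
move=> h1 h2 h3 h4; have [[_ _ ne _] _] := cr j.
case: (d j) (d' j) => [] [] //=; rewrite !(@met_betweenC (c j).1 (c j).2) //;
  by do 2!case: met_between; apply/val_inj.
Qed.

(** * The trip matrix of a decomposed diagram *)

Definition reparam (g : R -> R) (x : R * R) : R * R := (g x.1, g x.2).

Definition joint_labeling n (m : 'I_n -> nat) (g : nat -> R -> R)
    (c : forall j, 'I_(m j) -> R * R) (r : 'I_(\sum_j m j)) : R * R :=
  let p := tagnat.sig r in reparam (g (tag p)) (c (tag p) (tagged p)).

Lemma joint_labelingE n m g c (j : 'I_n) (a : 'I_(m j)) :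
  joint_labeling g c (tagnat.Rank j a) = reparam (g j) (c j a).
Proof. by rewrite /joint_labeling /tagnat.Rank tagnat.rankK. Qed.

(** Unlinkedness excludes a common parameter: the arc from [g j t] to itself
    meets the image of the partner of [t] but not [g j t]. *)
Lemma splits_disjoint Ps D g i j s t : splits Ps D g ->
  (i < size Ps)%N -> (j < size Ps)%N ->
  crossed (nth [::] Ps i) s -> crossed (nth [::] Ps j) t ->
  g i s = g j t -> i = j.
Proof.
move=> [gE gU _] iP jP cs [t' tt'] e; apply: contrapT => ij.
have [_ _ /eqP/negPf ne _] := embeds_double_point (gE j jP) tt'.
have := @gU i j iP jP ij (g i s) (g i s) (g j t) (g j t').
rewrite !met_betweenxx e eqxx eq_sym ne; case/(_ _ _ _ _)/esym/negP => //.
- by exists s.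
- by exists s.
- by exists t => //; exists t'.
- by exists t' => //; exists t; exact: double_pointC.
Qed.

Lemma embeds_crossings P D g x : embeds P D g ->
  crossings P x -> crossings D (reparam g x).
Proof.
move=> gE [st hst]; split; first exact: embeds_double_point st.
have [[_ e1 _] [_ e2 _]] := (gE.1 _ (crossedl st), gE.1 _ (crossedr st)).
by rewrite /= e1 e2.
Qed.

Section JointLabeling.
Variables (n : nat) (m : 'I_n -> nat) (Ps : seq (polygon R)) (D : polygon R).
Variables (g : nat -> R -> R) (c : forall j : 'I_n, 'I_(m j) -> R * R).
Hypotheses (sPs : size Ps = n) (gS : splits Ps D g).
Let P (j : 'I_n) : polygon R := nth [::] Ps j.
Hypothesis cP : forall j : 'I_n, labeling (P j) (@c j).

Let szP (j : 'I_n) : (j < size Ps)%N. Proof. by rewrite sPs. Qed.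

Let gE (j : 'I_n) : embeds (P j) D (g j).
Proof. by case: gS => gE _ _; exact: gE. Qed.

Let cross (j : 'I_n) (a : 'I_(m j)) : crossings (P j) (c a).
Proof. by case: (cP j) => cf _ _; exact: cf. Qed.

Let crossed1 (j : 'I_n) (a : 'I_(m j)) : crossed (P j) (c a).1.
Proof. by case: (cross a) => /crossedl. Qed.

Let crossed2 (j : 'I_n) (a : 'I_(m j)) : crossed (P j) (c a).2.
Proof. by case: (cross a) => /crossedr. Qed.

Lemma labeling_joint : labeling D (joint_labeling g c).
Proof.
split=> [r _|r s _ _|x [st hx]].
- exact: embeds_crossings (gE _) (cross _).
- rewrite -(tagnat.sig2K r) -(tagnat.sig2K s).
  move: (tagnat.sig1 r) (tagnat.sig1 s) (tagnat.sig2 r) (tagnat.sig2 s).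
  move=> i j a b; rewrite !joint_labelingE => -[e1 e2].
  have ij : i = j.
    by apply: val_inj; exact: splits_disjoint gS _ _ (crossed1 a) (crossed1 b) e1.
  subst j; congr tagnat.Rank; have [_ cI _] := cP i.
  have [_ gm] := gE i.
  apply: cI; rewrite ?inE //; apply/eqP; rewrite -pair_eqE /=; apply/andP; split.
    by apply/eqP; exact: cyclic_mono_inj gm _ _ e1.
  by apply/eqP; exact: cyclic_mono_inj gm _ _ e2.
- have [_ _ gC] := gS; have [i iP [s [t [st' es et]]]] := gC _ _ st.
  rewrite sPs in iP; pose j := Ordinal iP.
  have [_ p1 _] := (gE j).1 s (crossedl st').
  have [_ p2 _] := (gE j).1 t (crossedr st').
  have : crossings (P j) (s, t) by split=> //=; rewrite -p1 -p2 -es -et.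
  have [_ _ cS] := cP j => /cS[a _ ca].
  by exists (tagnat.Rank j a) => //; rewrite joint_labelingE ca /reparam -es -et; case: (x).
Qed.

(** Outside the diagonal blocks, unlinked crossings contribute twice the same
    boolean, which vanishes modulo 2. *)
Lemma trip_mx_joint (d : 'I_(\sum_j m j) -> bool) :
  trip_mx D (joint_labeling g c) d =
  \mxdiag_(j < n) trip_mx (P j) (@c j) (d \o @tagnat.Rank n m j).
Proof.
apply/mxblockP => i j; rewrite [in RHS]/mxdiag mxblockK.
apply/matrixP => a b; rewrite !mxE !joint_labelingE.
have [ij|ij] := eqVneq i j; last first.
  have /negPf -> : tagnat.Rank i a != tagnat.Rank j b.
    by apply: contra_neq ij => e; rewrite -(tagnat.Rank1K a) e tagnat.Rank1K.
  rewrite mxE; have [_ gU _] := gS.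
  have ji : (j : nat) <> i by move/val_inj => e; rewrite e eqxx in ij.
  have im k (x : 'I_(m k)) : (g k @` crossed (P k)) (g k (c x).1) /\
     (g k @` crossed (P k)) (g k (c x).2).
    by split; [exists (c x).1|exists (c x).2].
  have [a1 a2] := im i a; have [b1 b2] := im j b.
  have U := gU j i (szP j) (szP i) ji.
  rewrite /trip_meets /reparam /=; case: (d _).
    rewrite (U _ _ _ _ b1 b2 a1 a2); by case: met_between; apply/val_inj.
  rewrite (U _ _ _ _ b2 b1 a1 a2); by case: met_between; apply/val_inj.
subst j; rewrite conform_mx_id mxE /reparam /=.
have -> : (tagnat.Rank i a == tagnat.Rank i b) = (a == b).
  by rewrite /tagnat.Rank (inj_eq tagnat.rank_inj) eq_Tagged.
have [gs gm] := gE i.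
have [[_ _ e1] [_ _ e2]] := (gs _ (crossed1 a), gs _ (crossed2 a)).
by rewrite e1 e2 /trip_meets !gm.
Qed.

End JointLabeling.
End Reparametrization.

Theorem theorem3p3 (R : realType) (n : nat) (K : set 'rV[R]_3)
    (Ks : 'I_n -> set 'rV[R]_3) (n_ge2 : (2 <= n)%N)
    (Ks_prime : forall j, prime_knot (Ks j))
    (K_sum : connected_sum Ks K) :
  exists (m : 'I_n -> nat) (T : forall j : 'I_n, 'M['F_2]_(m j)),
    (forall j, trip_matrix_of (Ks j) (T j)) /\
    trip_matrix_of K (\mxdiag_(j < n) T j).
Proof.
have [Ps [D [PsK PsD DK]]] := K_sum.
have rP j : regular (Ps j) by case: (PsK j) => -[].
have [m mP] := choice (fun j => labeling_exists (rP j)).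
pose c j := projT1 (cid (mP j)); have cP j : labeling (Ps j) (c j).
  exact: projT2 (cid (mP j)).
exists m, (fun j => trip_mx (Ps j) (c j) (fun=> true)); split=> [j|].
  exists (Ps j), (c j); split=> // d; exact: trip_mx_direction.
have [g gS] := splits_iterated_composition PsD.
have nthP (j : 'I_n) : nth [::] [seq Ps j | j <- enum 'I_n] j = Ps j.
  by rewrite (nth_map j) ?nth_ord_enum // size_enum_ord.
have sz : size [seq Ps j | j <- enum 'I_n] = n by rewrite size_map size_enum_ord.
have cP' (j : 'I_n) : labeling (nth [::] [seq Ps j | j <- enum 'I_n] j) (c j).
  by rewrite nthP.
exists D, (joint_labeling g c); split=> //; first exact: labeling_joint cP'.
move=> d; rewrite (trip_mx_joint sz gS cP').
by apply: eq_mxdiag => j; rewrite nthP; exact: trip_mx_direction.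
Qed.
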